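(* Let $F$ be a distribution on $[0,\infty)$ with unbounded support, with $\hat\gamma\in(0,\infty]$ (so that $\varphi(\hat\gamma)\in(1,\infty]$). If for every fixed $y>0$ $$\liminf_{x\to\infty}\frac{\overline{F}(x-y)}{\overline{F}(x)}\ge e^{\hat\gamma y},$$ then $$\liminf_{x\to\infty}\frac{\overline{F*F}(x)}{\overline{F}(x)}=2\varphi(\hat\gamma).$$
   Context: $\overline{F}(x)=F(x,\infty)$ is the tail of $F$; unbounded support means $\overline{F}(x)>0$ for all $x$. $\varphi(\gamma)=\int_0^\infty e^{\gamma x}F(dx)\in(0,\infty]$, $\hat\gamma=\sup\{\gamma:\varphi(\gamma)<\infty\}\in[0,\infty]$, and $\varphi(\hat\gamma)=\lim_{\gamma\uparrow\hat\gamma}\varphi(\gamma)\in[1,\infty]$. When $\hat\gamma=\infty$, $e^{\hat\gamma y}$ is interpreted as $+\infty$ for $y>0$. *)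

(* Defs.v *)
From HB Require Import structures.
From mathcomp Require Import all_boot all_order all_algebra.
From mathcomp Require Import all_classical all_reals all_analysis.
Set Implicit Arguments. Unset Strict Implicit. Unset Printing Implicit Defensive.
Import Order.TTheory GRing.Theory Num.Theory.
Import numFieldNormedType.Exports.
Local Open Scope classical_set_scope.
Local Open Scope ring_scope.
Local Open Scope ereal_scope.

Section defs.
Context {R : realType}.
Variable F : probability (measurableTypeR R) R.

Definition tail (x : R) : R := fine (F `]x, +oo[%classic).

Definition conv_tail (x : R) : R :=
  fine ((F \x F) [set p : R * R | x < p.1 + p.2]%R).

Definition phi (g : R) : \bar R := \int[F]_(x in [set: R]) (expR (g * x))%:E.

Definition ghat : \bar R := ereal_sup [set g%:E | g in [set g | phi g < +oo]].

Definition phi_ghat : \bar R :=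
  match ghat with
  | r%:E => lim (phi @ r^'-)
  | _ => lim (phi @ +oo%R)
  end.

(* e^{gamma_hat y}, = +oo when gamma_hat = +oo (and y > 0) *)
Definition exp_ghat (y : R) : \bar R :=
  match ghat with
  | r%:E => (expR (r * y))%:E
  | +oo => +oo
  | -oo => 0
  end.

Definition on_nonneg : Prop := F [set x : R | x < 0]%R = 0.
Definition unbounded_support : Prop := forall x : R, (0 < tail x)%R.

End defs.

(* Main.v *)
(* Lower bound: one of two summands is at most x/2 on each of two disjoint
   subevents of {X1 + X2 > x}, so P(X1 + X2 > x) >= 2 E[1_{X <= x/2} tail(x - X)];
   divide by tail(x) and apply Fatou along a sequence realizing the liminf.

   Upper bound, for r = ghat finite and c = phi(r) finite: suppose
   P(X1 + X2 > a) >= (2c + e) P(X > a) for all a >= x0. Take the test function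
   f(x) = e^{rx} (w(x) - 1) with w(x) = min(e^{d x^+}, b), b >= 1, d > 0. As w is
   submultiplicative, m = E f(X) satisfies E f(X1 + X2) <= 2cm + m^2, whereas the
   assumption and the layer-cake formula give
   E f(X1 + X2) >= (2c + e)(m - f(x0)). Since phi(r + d) = +oo, m grows to +oo with
   b, by increments at most c times those of b, so b can be chosen with
   e/4 < m <= e/2, whatever d is; then m (e - m) is bounded below while
   f(x0) -> 0 as d -> 0, a contradiction. *)
Require Import Defs.
From HB Require Import structures.
From mathcomp Require Import all_boot all_order all_algebra.
From mathcomp Require Import all_classical all_reals all_analysis.
From mathcomp Require Import measurable_realfun ring lra.
Import Order.TTheory GRing.Theory Num.Theory.
Import numFieldNormedType.Exports.
Local Open Scope classical_set_scope.
Local Open Scope ring_scope.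

(** * Layer-cake formula and comparison of expectations through tails *)

Lemma ge0_integral_ccdf d (T : measurableType d) (R : realType)
    (P : probability T R) (q : T -> R) :
  measurable_fun setT q -> (forall x, 0 <= q x) ->
  (\int[P]_x (q x)%:E =
   \int[lebesgue_measure]_(t in `[0%R, +oo[) P (q @^-1` `]t, +oo[%classic))%E.
Proof.
move=> mq q0.
pose X : {RV P >-> R} := mfun_Sub (mem_set mq).
by have := @ge0_expectation_ccdf _ _ _ P X q0; rewrite unlock.
Qed.

Lemma measurable_fun_ccdf d (T : measurableType d) (R : realType)
    (P : probability T R) (q : T -> R) (D : set R) :
  measurable_fun setT q ->
  measurable_fun D (fun t : R => P (q @^-1` `]t, +oo[%classic)).
Proof.
move=> mq; pose X : {RV P >-> R} := mfun_Sub (mem_set mq).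
by apply: measurable_funTS; exact: (ccdf_measurable X).
Qed.

(** The endpoint is the supremum of the sublevel set [A]: [x1] bounds [A] by monotonicity, the
    supremum lies in [A] by continuity, and it is at least [x0] because [x0] lies in [A]. *)
Lemma superlevel_set_itv (R : realType) (f : R -> R) (s x0 x1 : R) :
  continuous f -> {homo f : x y / x <= y} -> f x0 <= s -> s < f x1 ->
  exists2 a, x0 <= a & [set x | s < f x] = `]a, +oo[%classic.
Proof.
move=> cf ndf fx0 fx1; pose A := [set x | f x <= s].
have A0 : A !=set0 by exists x0.
have ubA : ubound A x1.
  by move=> x Ax; rewrite leNgt; apply/negP => /ltW/ndf; rewrite leNgt (le_lt_trans Ax).
have supA : has_sup A by split => //; exists x1.
have clA : closed A.
  by apply: (@preimage_closed _ _ f [set y | y <= s]) => [x _|]; [exact: cf|exact: closed_le].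
have Asup : A (sup A).
  have : closure A (sup A) by apply: closure_sup => //; exists x1.
  by rewrite -(iffLR (closure_id A) clA).
exists (sup A); first by apply: ub_le_sup => //; exists x1.
apply/seteqP; split => x /=; rewrite in_itv/= andbT.
  by move=> sfx; rewrite ltNge; apply/negP => /ndf; rewrite leNgt (le_lt_trans Asup).
by move=> ax; rewrite ltNge; apply/negP => fxs; move: ax; rewrite ltNge ub_le_sup//; exists x1.
Qed.

(** In the layer-cake formula each level [t >= 0] of the truncated function corresponds to a level
    [a >= x0] of the variable. Cutting [f - f x0] at 0 is what confines the tail comparison to such
    [a]. *)
Lemma ge0_le_integral_ccdf d1 d2 (T1 : measurableType d1) (T2 : measurableType d2)
    (R : realType) (P : probability T1 R) (Q : probability T2 R)
    (X : T1 -> R) (Y : T2 -> R) (f : R -> R) (k x0 : R) :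
  measurable_fun setT X -> measurable_fun setT Y ->
  continuous f -> {homo f : x y / x <= y} -> 0 <= k ->
  (forall a, x0 <= a ->
    (k%:E * P (X @^-1` `]a, +oo[%classic) <= Q (Y @^-1` `]a, +oo[%classic))%E) ->
  (k%:E * \int[P]_x (Num.max (f (X x) - f x0) 0)%:E <=
   \int[Q]_y (Num.max (f (Y y) - f x0) 0)%:E)%E.
Proof.
move=> mX mY cf ndf k0 kPQ.
have mf : measurable_fun setT f by exact: continuous_measurable_fun.
have mg : measurable_fun setT (fun x => Num.max (f x - f x0) 0).
  by apply: measurable_maxr => //; apply: measurable_funB.
have mgX : measurable_fun setT (fun t => Num.max (f (X t) - f x0) 0).
  exact: (measurableT_comp mg mX).
have mgY : measurable_fun setT (fun t => Num.max (f (Y t) - f x0) 0).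
  exact: (measurableT_comp mg mY).
have g0 x : 0 <= Num.max (f x - f x0) 0 by rewrite le_max lexx orbT.
rewrite !ge0_integral_ccdf//.
rewrite -ge0_integralZl//; last exact: measurable_fun_ccdf.
apply: ge0_le_integral => //.
- by move=> t _; rewrite mule_ge0.
- by apply: measurable_funeM; exact: measurable_fun_ccdf.
- exact: measurable_fun_ccdf.
move=> t; rewrite /= in_itv/= andbT => t0.
have gE (x : R) : (t < Num.max (f x - f x0) 0) = (t + f x0 < f x).
  by rewrite lt_max ltrBrDr [X in _ || X]ltNge t0 orbF.
(* If [f] never exceeds [t + f x0], the event on the left is empty; otherwise both events are rays
   beyond the same [a]. *)
have [[x1 fx1]|nx1] := pselect (exists x1, t + f x0 < f x1).
  have fx0 : f x0 <= t + f x0 by rewrite lerDr.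
  have [a x0a E] := @superlevel_set_itv _ _ _ _ _ cf ndf fx0 fx1.
  have gE' T (Z : T -> R) :
    (fun t => Num.max (f (Z t) - f x0) 0) @^-1` `]t, +oo[ = Z @^-1` `]a, +oo[.
    by rewrite -E; apply/seteqP; split => z /=; rewrite in_itv/= andbT gE.
  by rewrite !gE'; exact: kPQ.
rewrite (_ : _ @^-1` _ = set0) ?measure0 ?mule0//.
apply/seteqP; split => z //=; rewrite in_itv/= andbT gE => H.
by apply: nx1; exists (X z).
Qed.

Lemma ge0_integral_prod (R : realType) (F : probability (measurableTypeR R) R)
    (a b : R -> R) :
  measurable_fun setT a -> measurable_fun setT b ->
  (forall x, 0 <= a x) -> (forall x, 0 <= b x) ->
  (\int[F \x F]_p (a p.1 * b p.2)%:E = (\int[F]_x (a x)%:E) * \int[F]_x (b x)%:E)%E.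
Proof.
move=> ma mb a0 b0; have mab : measurable_fun setT (fun p : R * R => (a p.1 * b p.2)%:E).
  apply/measurable_EFinP; apply: measurable_funM.
    exact: (measurableT_comp ma measurable_fst).
  exact: (measurableT_comp mb measurable_snd).
rewrite fubini_tonelli1//=; last by move=> p; rewrite lee_fin mulr_ge0.
have mEa : measurable_fun setT (EFin \o a) by exact/measurable_EFinP.
have mEb : measurable_fun setT (EFin \o b) by exact/measurable_EFinP.
rewrite muleC -ge0_integralZl//;
  [|by move=> x _ /=; rewrite lee_fin a0|by apply: integral_ge0 => x _; rewrite lee_fin b0].
apply: eq_integral => x _; rewrite /fubini_F/= muleC.
under eq_integral do rewrite EFinM.
by rewrite ge0_integralZl//= => [y _|]; rewrite lee_fin ?b0 ?a0.
Qed.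

(** * The capped exponential weight and its tilt *)

(** The positive part keeps the weight at least 1 on the whole line when [d >= 0] and [b >= 1], so
    that [tilt] is nonnegative there. *)
Definition trunc_expR {R : realType} (d b x : R) : R :=
  Num.min (expR (d * Num.max x 0)) b.

(* The factor [b >= 1] caps the extra exponential growth, so that integrals of
   [tilt g d b] stay finite as soon as [expR (g * x)] is integrable. *)
Definition tilt {R : realType} (g d b x : R) : R :=
  expR (g * x) * (trunc_expR d b x - 1).

Lemma trunc_expR_ge1 (R : realType) (d b x : R) : 0 <= d -> 1 <= b ->
  1 <= trunc_expR d b x.
Proof.
move=> d0 b1; rewrite /trunc_expR le_min b1 andbT -expR0 ler_expR.
by rewrite mulr_ge0// le_max lexx orbT.
Qed.

(** If neither factor is capped, the right side is [s * t]; otherwise it is [b] times a factor at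
    least 1. *)
Lemma minr_submul (R : realType) (b s t : R) : 1 <= b -> 1 <= s -> 1 <= t ->
  Num.min (s * t) b <= Num.min s b * Num.min t b.
Proof.
move=> b1 s1 t1; have [sb|/ltW bs] := leP s b; have [tb|/ltW bt] := leP t b.
- by rewrite ge_min lexx.
- by rewrite ge_min [b <= s * b]ler_peMl ?orbT// (le_trans ler01).
- by rewrite ge_min [b <= b * t]ler_peMr ?orbT// (le_trans ler01).
- by rewrite ge_min [b <= b * b]ler_peMr ?orbT// (le_trans ler01).
Qed.

(** The positive part is subadditive, so the uncapped exponential is submultiplicative, and
    [minr_submul] carries this over to the cap. *)
Lemma trunc_expRD (R : realType) (d b x y : R) : 0 <= d -> 1 <= b ->
  trunc_expR d b (x + y) <= trunc_expR d b x * trunc_expR d b y.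
Proof.
move=> d0 b1.
have e1 z : 1 <= expR (d * Num.max z 0).
  by rewrite -expR0 ler_expR mulr_ge0// le_max lexx orbT.
apply: le_trans (minr_submul _ _ _ _ b1 (e1 x) (e1 y)).
rewrite /trunc_expR le_min !ge_min lexx orbT andbT -expRD ler_expR -mulrDr.
rewrite ler_wpM2l//= ge_max addr_ge0 ?le_max ?lexx ?orbT// andbT.
by rewrite lerD// le_max lexx.
Qed.

Lemma tilt_ge0 (R : realType) (g d b x : R) : 0 <= d -> 1 <= b ->
  0 <= tilt g d b x.
Proof. by move=> d0 b1; rewrite mulr_ge0 ?expR_ge0// subr_ge0 trunc_expR_ge1. Qed.

Lemma tilt_nondecreasing (R : realType) (g d b : R) : 0 <= g -> 0 <= d -> 1 <= b ->
  {homo tilt g d b : x y / x <= y}.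
Proof.
move=> g0 d0 b1 x y xy; apply: ler_pM; rewrite ?expR_ge0//.
- by rewrite subr_ge0 trunc_expR_ge1.
- by rewrite ler_expR ler_wpM2l.
rewrite lerD2r /trunc_expR le_min !ge_min lexx orbT andbT; apply/orP; left.
by rewrite ler_expR ler_wpM2l// ge_max !le_max xy lexx orbT.
Qed.

(** With exponentials [p], [q] and weights [u], [v], the right side collapses to
    [p * q * (u * v - 1)], so submultiplicativity of the weight suffices. *)
Lemma tiltD (R : realType) (g d b x y : R) : 0 <= d -> 1 <= b ->
  tilt g d b (x + y) <= tilt g d b x * expR (g * y) +
    expR (g * x) * tilt g d b y + tilt g d b x * tilt g d b y.
Proof.
move=> d0 b1; rewrite /tilt (mulrDr g) expRD.
have E (p q u v : R) : p * (u - 1) * q + p * (q * (v - 1)) +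
    p * (u - 1) * (q * (v - 1)) = p * q * (u * v - 1) by ring.
by rewrite E ler_wpM2l ?mulr_ge0 ?expR_ge0// lerB// trunc_expRD.
Qed.

Lemma continuous_tilt (R : realType) (g d b : R) : continuous (tilt g d b).
Proof.
have cM (c : R) (h : R -> R) : continuous h -> continuous (fun y => expR (c * h y)).
  move=> ch x; apply: (@continuous_comp _ _ _ (fun y => c * h y) expR).
    by apply: (@cvgM R); [exact: cvg_cst|exact: ch].
  exact: continuous_expR.
have cmax : continuous (fun y : R => Num.max y 0).
  by move=> x; apply: (@continuous_max R R id (cst 0) x); [exact: cvg_id|exact: cvg_cst].
move=> x; apply: (@cvgM R); first by apply: cM => y; exact: cvg_id.
apply: (@cvgB R R^o); last exact: cvg_cst.
apply: (@continuous_min R R (fun y => expR (d * Num.max y 0)) (cst b) x).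
  exact: cM.
exact: cvg_cst.
Qed.

Lemma measurable_expRZ (R : realType) (g : R) :
  measurable_fun setT (fun x : R => (expR (g * x))%:E).
Proof.
apply/measurable_EFinP; apply: continuous_measurable_fun => x.
apply: (@continuous_comp _ _ _ (fun y => g * y) expR); last exact: continuous_expR.
by apply: (@cvgM R); [exact: cvg_cst|exact: cvg_id].
Qed.

Lemma measurable_tilt (R : realType) (g d b : R) :
  measurable_fun setT (tilt g d b).
Proof. by apply: continuous_measurable_fun; exact: continuous_tilt. Qed.

(** * Integrals of the tilt as functions of the cap *)

Section tilted_integrals.
Context {R : realType} (F : probability (measurableTypeR R) R).
Variables (g d : R).
Hypothesis d0 : 0 <= d.

Let mexp : measurable_fun setT (fun x : R => expR (g * x)).
Proof. by apply/measurable_EFinP; exact: measurable_expRZ. Qed.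

Let tilt_ge0E b x : 1 <= b -> (0 <= (tilt g d b x)%:E)%E.
Proof. by move=> b1; rewrite lee_fin tilt_ge0. Qed.

Lemma integral_tiltD_le (b : R) : 1 <= b ->
  (\int[F \x F]_p (tilt g d b (p.1 + p.2)%R)%:E <=
    (\int[F]_x (tilt g d b x)%:E) * (\int[F]_x (expR (g * x))%:E) +
    (\int[F]_x (expR (g * x))%:E) * (\int[F]_x (tilt g d b x)%:E) +
    (\int[F]_x (tilt g d b x)%:E) * (\int[F]_x (tilt g d b x)%:E))%E.
Proof.
move=> b1; have mt := @measurable_tilt R g d b.
have t0 x : 0 <= tilt g d b x by rewrite tilt_ge0.
have e0 x : 0 <= expR (g * x) by exact: expR_ge0.
have mM (u v : R -> R) : measurable_fun setT u -> measurable_fun setT v ->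
    measurable_fun setT (fun p : R * R => (u p.1 * v p.2)%:E).
  move=> mu mv; apply/measurable_EFinP; apply: measurable_funM.
    exact: (measurableT_comp mu measurable_fst).
  exact: (measurableT_comp mv measurable_snd).
have me2 := mM _ _ mt mexp; have m2e := mM _ _ mexp mt; have m22 := mM _ _ mt mt.
have pos (u v : R -> R) : (forall x, 0 <= u x) -> (forall x, 0 <= v x) ->
    forall p : R * R, setT p -> (0 <= (u p.1 * v p.2)%:E)%E.
  by move=> u0 v0 p _; rewrite lee_fin mulr_ge0.
have pte := pos _ _ t0 e0; have pet := pos _ _ e0 t0; have ptt := pos _ _ t0 t0.
rewrite -!ge0_integral_prod//.
rewrite -(ge0_integralD (F \x F)%E measurableT pte me2 pet m2e).
rewrite -(ge0_integralD (F \x F)%E measurableT _ (emeasurable_funD me2 m2e) ptt m22); last first.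
  by move=> p pT; rewrite adde_ge0// ?pte ?pet.
apply: ge0_le_integral => //.
- by move=> p _; rewrite lee_fin.
- apply/measurable_EFinP; apply: (measurableT_comp mt).
  by apply: measurable_funD; [exact: measurable_fst|exact: measurable_snd].
- by do 2 apply: emeasurable_funD => //.
- by move=> p _; rewrite -!EFinD lee_fin tiltD.
Qed.

(** Raising the cap by [h] raises the weight by at most [h]. This prevents the integral from jumping
    over a target window as the cap grows. *)
Lemma integral_tilt_step (b h : R) : 1 <= b -> 0 <= h ->
  (\int[F]_x (tilt g d (b + h) x)%:E <=
   \int[F]_x (tilt g d b x)%:E + h%:E * \int[F]_x (expR (g * x))%:E)%E.
Proof.
move=> b1 h0; have bh1 : 1 <= b + h by rewrite (le_trans b1)// lerDl.
have me := measurable_expRZ R g.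
have e0 (x : R) : setT x -> (0 <= (expR (g * x))%:E)%E.
  by move=> _; rewrite lee_fin expR_ge0.
have mtE b' : measurable_fun setT (fun x => (tilt g d b' x)%:E).
  by apply/measurable_EFinP; exact: measurable_tilt.
rewrite -ge0_integralZl//.
have t0 x : setT x -> (0 <= (tilt g d b x)%:E)%E by move=> _; exact: tilt_ge0E.
have he0 x : setT x -> (0 <= h%:E * (expR (g * x))%:E)%E.
  by move=> xT; rewrite mule_ge0// e0.
rewrite -(ge0_integralD F measurableT t0 (mtE b) he0 (measurable_funeM h%:E me)).
apply: ge0_le_integral => //.
- by move=> x _; exact: tilt_ge0E.
- exact: mtE.
- exact: (emeasurable_funD (mtE b) (measurable_funeM h%:E me)).
move=> x _; rewrite -EFinM -EFinD lee_fin /tilt [h * _]mulrC -mulrDr.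
rewrite ler_wpM2l ?expR_ge0//.
suff : trunc_expR d (b + h) x <= trunc_expR d b x + h by lra.
rewrite /trunc_expR -lerBlDr le_min !lerBlDr.
by rewrite !ge_min lexx orbT andbT lerDl h0.
Qed.

(** If all these integrals were at most [M], monotone convergence would bound the integral of the
    uncapped tilt, and adding back the integral of [expR (g * x)] would make that of
    [expR ((g + d) * x)] finite. *)
Lemma integral_tilt_unbounded (h M : R) : 0 < h ->
  (\int[F]_x (expR (g * x))%:E < +oo)%E ->
  (\int[F]_x (expR ((g + d) * x))%:E = +oo)%E ->
  exists k : nat, (M%:E < \int[F]_x (tilt g d (1 + k%:R * h) x)%:E)%E.
Proof.
move=> h0 fin inf; apply: contrapT => /forallNP tM.
have b1 (k : nat) : 1 <= 1 + k%:R * h by rewrite lerDl mulr_ge0// ltW.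
have mt k : measurable_fun setT (fun x => (tilt g d (1 + k%:R * h) x)%:E).
  by apply/measurable_EFinP; exact: measurable_tilt.
have t0 (k : nat) x : setT x -> (0 <= (tilt g d (1 + k%:R * h) x)%:E)%E.
  by move=> _; exact: tilt_ge0E.
have nd x : setT x ->
    {homo (fun k : nat => (tilt g d (1 + k%:R * h) x)%:E) : n m / (n <= m)%N >-> (n <= m)%E}.
  move=> _ n m nm; rewrite lee_fin /tilt ler_wpM2l ?expR_ge0// lerB//.
  rewrite /trunc_expR le_min !ge_min lexx/=.
  by rewrite lerD2l ler_wpM2r ?ler_nat ?nm ?orbT// ltW.
have := monotone_convergence F measurableT mt t0 nd.
have limM : (limn (fun k : nat => \int[F]_x (tilt g d (1 + k%:R * h) x)%:E) <= M%:E)%E.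
  apply: lime_le; last by apply: nearW => k; rewrite leNgt; apply/negP/tM.
  apply: ereal_nondecreasing_is_cvgn => n m nm.
  by apply: (ge0_le_integral F measurableT (t0 n) (mt n) (mt m)) => x xT; exact: nd.
move=> E; move: limM; rewrite -{}E => leM.
suff : (\int[F]_x (expR ((g + d) * x))%:E <= M%:E + \int[F]_x (expR (g * x))%:E)%E.
  by rewrite inf leNgt lte_add_pinfty// ltry.
apply: (le_trans _ (leeD leM (lexx _))).
have lim0 x : setT x -> (0 <= limn (fun k : nat => (tilt g d (1 + k%:R * h) x)%:E))%E.
  move=> _; apply: lime_ge; first by apply: ereal_nondecreasing_is_cvgn; exact: nd.
  by apply: nearW => k; exact: t0.
have mlim : measurable_fun setT
    (fun x => limn (fun k : nat => (tilt g d (1 + k%:R * h) x)%:E)).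
  apply: (emeasurable_fun_cvg (fun k x => (tilt g d (1 + k%:R * h) x)%:E)) => // x _.
  by apply: ereal_nondecreasing_is_cvgn; exact: nd.
have me := measurable_expRZ R.
have e0 (c x : R) : setT x -> (0 <= (expR (c * x))%:E)%E by move=> _; rewrite lee_fin expR_ge0.
rewrite -(ge0_integralD F measurableT lim0 mlim (e0 g) (me g)).
apply: (ge0_le_integral F measurableT (e0 (g + d)) (me (g + d)) (emeasurable_funD mlim (me g))).
move=> x _; rewrite -leeBlDr// -EFinB.
apply: lime_ge; first by apply: ereal_nondecreasing_is_cvgn; exact: nd.
(* For large [k] the cap is inactive at [x], and [x] is at most its positive part. *)
near=> k; rewrite lee_fin /tilt /trunc_expR.
have kb : expR (d * Num.max x 0) <= 1 + k%:R * h.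
  rewrite -lerBlDl -ler_pdivrMr//; near: k; exact: nbhs_infty_ger.
rewrite (min_idPl kb) mulrBr mulr1 lerB// -expRD ler_expR mulrDl lerD2l.
by rewrite ler_wpM2l// le_max lexx.
Unshelve. all: by end_near. Qed.

End tilted_integrals.

(** * Contradiction from a uniform excess of the convolution tail *)

Lemma trunc_expR1 (R : realType) (d x : R) : 0 <= d -> trunc_expR d 1 x = 1.
Proof.
move=> d0; apply/min_idPr; rewrite -expR0 ler_expR mulr_ge0//.
by rewrite le_max lexx orbT.
Qed.

Lemma no_uniform_excess (R : realType) (F : probability (measurableTypeR R) R)
    (g c e x0 : R) :
  0 <= g -> (\int[F]_x (expR (g * x))%:E = c%:E)%E ->
  (forall d, 0 < d -> (\int[F]_x (expR ((g + d) * x))%:E = +oo)%E) ->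
  0 < e -> 0 < x0 ->
  (forall a, x0 <= a -> ((2 * c + e)%:E * F `]a, +oo[%classic <=
    (F \x F) [set p : R * R | (a < p.1 + p.2)%R])%E) -> False.
Proof.
move=> g0 phig phioo e0 x00 excess.
have c0 : 0 <= c.
  by rewrite -lee_fin -phig integral_ge0// => x _; rewrite lee_fin expR_ge0.
pose k := 2 * c + e; have k0 : 0 < k by rewrite /k; lra.
(* With [d] chosen so that [expR (d * x0) = 1 + s], the tilt at [x0] is at most [expR (g * x0) * s];
   the value of [s] then yields [k * f x0 <= e ^+ 2 / 16], whatever the cap. *)
pose s := e ^+ 2 / 16 / (k * expR (g * x0)).
have s0 : 0 < s by rewrite !divr_gt0 ?exprn_gt0 ?mulr_gt0 ?expR_gt0.
pose d := ln (1 + s) / x0.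
have d0 : 0 < d by rewrite divr_gt0// ln_gt0// ltrDl.
(* One step of the cap raises the integral by at most [h * c <= e / 4]; adding 1 to [c] keeps the
   denominator positive. *)
pose h := e / (4 * (c + 1)).
have h0 : 0 < h by rewrite divr_gt0//; lra.
have hc : h * c <= e / 4.
  have c4 : 0 < 4 * (c + 1) by lra.
  rewrite /h mulrAC ler_pdivrMr//.
  by rewrite (_ : e / 4 * _ = e * c + e) ?lerDl ?ltW//; field.
have d0' := ltW d0.
pose m n := (\int[F]_x (tilt g d (1 + n%:R * h) x)%:E)%E.
have b1 (n : nat) : 1 <= 1 + n%:R * h by rewrite lerDl mulr_ge0// ltW.
have ex : exists n, ((e / 4)%:E < m n)%E.
  apply: (integral_tilt_unbounded F g d d0' h (e / 4) h0); first by rewrite phig ltry.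
  exact: phioo.
(* Take the least index whose integral exceeds [e / 4]. It is not 0, since the tilt vanishes for cap
   1, so its predecessor is at most [e / 4] and one step leads to at most [e / 2]. *)
have [[|n] mn nmin] := ex_minnP ex.
  move: mn; rewrite /m mul0r addr0.
  under eq_integral do rewrite /tilt trunc_expR1// subrr mulr0.
  by rewrite integral0 lte_fin ltNge => /negP; apply; rewrite divr_ge0// ltW.
have mn_le : (m n.+1 <= (e / 2)%:E)%E.
  have mn' : (m n <= (e / 4)%:E)%E.
    by rewrite leNgt; apply/negP => /nmin; rewrite ltnn.
  have := integral_tilt_step F g d d0' _ h (b1 n) (ltW h0).
  rewrite -addrA -{2}(mul1r h) -mulrDl natr1 phig -EFinM => /le_trans; apply.
  have -> : (e / 2)%:E = ((e / 4)%:E + (e / 4)%:E)%E by rewrite -EFinD; congr EFin; lra.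
  by rewrite leeD// lee_fin.
set b := 1 + n.+1%:R * h in mn_le mn *.
have {}b1 : 1 <= b := b1 n.+1.
pose f := tilt g d b.
have mE : (\int[F]_x (f x)%:E = m n.+1)%E by [].
have m_fin : m n.+1 \is a fin_num.
  by rewrite ge0_fin_numE ?(le_lt_trans mn_le) ?ltry// ltW// (le_lt_trans _ mn)// lee_fin divr_ge0// ltW.
pose M := fine (m n.+1).
have ME : m n.+1 = M%:E by rewrite fineK.
move: mn mn_le; rewrite ME !(lee_fin, lte_fin) => Mgt Mle.
have f0 x : 0 <= f x by exact: tilt_ge0.
have fx0 : k * f x0 <= e ^+ 2 / 16.
  have ds : expR (d * x0) = 1 + s by rewrite /d divfK ?gt_eqF// lnK// posrE; lra.
  have : f x0 <= expR (g * x0) * s.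
    rewrite /f /tilt ler_wpM2l ?expR_ge0// lerBlDl /trunc_expR ge_min.
    by rewrite (max_idPl (ltW x00)) ds lexx.
  move=> /(ler_wpM2l (ltW k0)) /le_trans; apply.
  by rewrite mulrA mulrC divfK// gt_eqF// mulr_gt0// expR_gt0.
have mf : measurable_fun setT f by exact: measurable_tilt.
have mpf : measurable_fun setT (fun x => Num.max (f x - f x0) 0).
  by apply: measurable_maxr => //; apply: measurable_funB.
have mS : measurable_fun setT (fun p : R * R => p.1 + p.2).
  by apply: measurable_funD; [exact: measurable_fst|exact: measurable_snd].
have conv : (\int[F \x F]_p (Num.max (f (p.1 + p.2)%R - f x0) 0)%:E <=
    (2 * c * M + M ^+ 2)%:E)%E.
  apply: (@le_trans _ _ (\int[F \x F]_p (f (p.1 + p.2)%R)%:E)%E).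
    apply: ge0_le_integral => //.
    - by move=> p _; rewrite lee_fin le_max lexx orbT.
    - by apply/measurable_EFinP; exact: (measurableT_comp mpf mS).
    - by apply/measurable_EFinP; exact: (measurableT_comp mf mS).
    - by move=> p _; rewrite lee_fin ge_max f0 andbT gerBl.
  apply: (le_trans (integral_tiltD_le F g d d0' b b1)).
  rewrite -/f mE ME phig -!EFinM -!EFinD lee_fin.
  by rewrite le_eqVlt; apply/orP; left; apply/eqP; ring.
have := @ge0_le_integral_ccdf _ _ _ _ R F (F \x F)%E id (fun p : R * R => p.1 + p.2) f k x0
  (@measurable_id _ _ _) mS (@continuous_tilt R g d b)
  (@tilt_nondecreasing R g d b g0 d0' b1) (ltW k0).
have ccdf a : x0 <= a -> (k%:E * F (id @^-1` `]a, +oo[%classic) <=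
  (F \x F) ((fun p : R * R => (p.1 + p.2)%R) @^-1` `]a, +oo[%classic))%E.
  move=> /excess; rewrite -/k; congr (_ <= (F \x F)%E _)%E.
  by apply/seteqP; split => p /=; rewrite in_itv/= andbT.
move=> /(_ ccdf) /le_trans/(_ conv).
set I := (\int[F]_x _)%E => kI.
have I0 : (0 <= I)%E by apply: integral_ge0 => x _; rewrite lee_fin le_max lexx orbT.
(* Pointwise [f] is at most its truncated excess over [f x0] plus [f x0], and [F] has mass 1. *)
have MI : (M%:E <= I + (f x0)%:E)%E.
  have -> : (f x0)%:E = (\int[F]_x (cst (f x0)%:E x))%E.
    by rewrite integral_cst//= probability_setT mule1.
  have p0 x : setT x -> (0 <= (Num.max (f x - f x0) 0)%:E)%E.
    by move=> _; rewrite lee_fin le_max lexx orbT.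
  have mpE : measurable_fun setT (fun x => (Num.max (f x - f x0) 0)%:E).
    by apply/measurable_EFinP.
  have c0E (x : R) : setT x -> (0 <= cst (f x0)%:E x)%E by rewrite lee_fin.
  have mcE : measurable_fun setT (fun x : R => cst (f x0)%:E x) by [].
  rewrite /I -(ge0_integralD F measurableT p0 mpE c0E mcE) -ME -mE.
  apply: (ge0_le_integral F measurableT _ _ (emeasurable_funD mpE mcE)).
  - by move=> x _; rewrite lee_fin.
  - by apply/measurable_EFinP.
  - by move=> x _; rewrite /= -EFinD lee_fin -lerBlDr le_max lexx.
have I_fin : I \is a fin_num.
  rewrite ge0_fin_numE// ltNge leye_eq; apply/negP => /eqP Ioo.
  by move: kI; rewrite Ioo gt0_muley ?lte_fin// leye_eq.
move: MI kI; rewrite -(fineK I_fin) -EFinM -EFinD !lee_fin.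
set J := fine I => MI kI.
have : k * M <= 2 * c * M + M ^+ 2 + k * f x0.
  by rewrite (le_trans (ler_wpM2l (ltW k0) MI))// mulrDr lerD2r.
rewrite /k => kM.
have : M * (e - M) <= e ^+ 2 / 16.
  rewrite (le_trans _ fx0)// /k; lra.
(* As [M] lies in []e / 4, e / 2]], these products give [M * (e - M) > 3 * e ^+ 2 / 16], against the
   bound [e ^+ 2 / 16]. *)
have : 0 <= (M - e / 4) * (e / 2 - M) by apply: mulr_ge0; lra.
have : 0 < (M - e / 4) * e by apply: mulr_gt0; lra.
have : 0 < e ^+ 2 by rewrite exprn_gt0.
nra.
Qed.

(** * Tails of [F] and a lower bound for the convolution tail *)

Lemma tailE (R : realType) (F : probability (measurableTypeR R) R) (x : R) :
  F `]x, +oo[%classic = (tail F x)%:E.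
Proof. by rewrite /tail fineK// fin_num_measure. Qed.

Lemma tail_ge0 (R : realType) (F : probability (measurableTypeR R) R) (x : R) :
  0 <= tail F x.
Proof. by rewrite -lee_fin -tailE. Qed.

Lemma measurable_sum_gt (R : realType) (x : R) :
  measurable [set p : R * R | x < p.1 + p.2].
Proof.
have mS : measurable_fun setT (fun p : R * R => p.1 + p.2).
  by apply: measurable_funD; [exact: measurable_fst|exact: measurable_snd].
rewrite (_ : mkset _ = setT `&` (fun p : R * R => p.1 + p.2) @^-1` `]x, +oo[%classic).
  exact: mS.
by rewrite setTI; apply/seteqP; split => p /=; rewrite in_itv/= andbT.
Qed.

Lemma conv_tailE (R : realType) (F : probability (measurableTypeR R) R) (x : R) :
  (F \x F)%E [set p : R * R | x < p.1 + p.2] = (conv_tail F x)%:E.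
Proof.
rewrite /conv_tail fineK//.
pose FF : probability _ R := (F \x F)%E.
exact: (fin_num_measure FF _ (measurable_sum_gt R x)).
Qed.

Lemma tail_nonincreasing (R : realType) (F : probability (measurableTypeR R) R) :
  {homo tail F : x y /~ x <= y}.
Proof.
move=> x y xy; rewrite -lee_fin -!tailE; apply: le_measure; rewrite ?inE//.
by apply: subset_itvr; rewrite bnd_simp.
Qed.

(** This is the [F]-measure of the section at [y] of the event that the sum exceeds [x] while the
    first summand is at most [x / 2]. *)
Definition half_tail {R : realType} (F : probability (measurableTypeR R) R)
    (x y : R) : R :=
  \1_[set z : R | z <= x / 2] y * tail F (x - y).

Lemma measurable_half_tail (R : realType) (F : probability (measurableTypeR R) R) (x : R) :
  measurable_fun setT (half_tail F x).
Proof.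
apply: measurable_funM.
  apply: measurable_indic; rewrite (_ : mkset _ = `]-oo, x / 2]%classic).
    exact: measurable_itv.
  by apply/seteqP; split => z /=; rewrite in_itv.
apply: nondecreasing_measurable => // y z yz; apply: tail_nonincreasing.
by rewrite lerD2l lerN2.
Qed.

Lemma half_tail_ge0 (R : realType) (F : probability (measurableTypeR R) R) (x y : R) :
  0 <= half_tail F x y.
Proof. by rewrite mulr_ge0 ?tail_ge0// indicE. Qed.

(* [A] and [B] ask one summand to be at most [x / 2]; the sum being larger than
   [x], this cannot hold for both. *)
Lemma conv_tail_ge (R : realType) (F : probability (measurableTypeR R) R) (x : R) :
  (2%:E * \int[F]_y (half_tail F x y)%:E <= (conv_tail F x)%:E)%E.
Proof.
set S := [set p : R * R | x < p.1 + p.2].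
have mS : measurable S by exact: measurable_sum_gt.
pose A := S `&` [set p : R * R | p.1 <= x / 2].
pose B := S `&` [set p : R * R | p.2 <= x / 2].
have mI : measurable (`]-oo, x / 2]%classic : set R) by [].
have mA : measurable A.
  apply: measurableI => //; rewrite (_ : mkset _ = setT `&` fst @^-1` `]-oo, x / 2]%classic).
    exact: (@measurable_fst _ _ R R).
  by rewrite setTI; apply/seteqP; split => z /=; rewrite in_itv.
have mB : measurable B.
  apply: measurableI => //; rewrite (_ : mkset _ = setT `&` snd @^-1` `]-oo, x / 2]%classic).
    exact: (@measurable_snd _ _ R R).
  by rewrite setTI; apply/seteqP; split => z /=; rewrite in_itv.
have secE (s : set R) y : s = [set z | x < y + z /\ y <= x / 2] ->
    (half_tail F x y)%:E = F s.
  move=> ->; rewrite /half_tail indicE.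
  have [yx|xy] := leP y (x / 2).
    rewrite mem_set//= mul1r -tailE; congr (F _); apply/seteqP.
    by split => z /=; rewrite in_itv/= andbT ltrBlDl => // -[].
  rewrite memNset/= ?mul0r; last by apply/negP; rewrite -ltNge.
  rewrite (_ : mkset _ = set0) ?measure0//.
  by apply/seteqP; split => z //= [].
have FA : (F \x F)%E A = (\int[F]_y (half_tail F x y)%:E)%E.
  apply: eq_integral => y _ /=; apply/esym/secE; rewrite xsectionE.
  by apply/seteqP; split.
have FB : (F \x F)%E B = (\int[F]_y (half_tail F x y)%:E)%E.
  (* Uniqueness of the product measure allows slicing at a fixed second coordinate; the slices of
     [B] are then those of [A] with the coordinates exchanged. *)
  transitivity ((F \x^ F)%E B).
    by apply: product_measure_unique => //= ? ? ? ?; rewrite product_measure2E.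
  apply: eq_integral => y _ /=; apply/esym/secE; rewrite ysectionE.
  by apply/seteqP; split => z /=; rewrite addrC.
rewrite -conv_tailE -/S (_ : 2%:E = 1 + 1)%E// ge0_muleDl// mul1e.
rewrite -{1}FA -FB -measureU//; last first.
  apply/seteqP; split => p //= -[[+ p1] [_ p2]]; rewrite /S/=.
  by move=> xp; move: p1 p2 xp => /=; lra.
by apply: le_measure; rewrite ?inE//; [exact: measurableU|move=> p [[]|[]]].
Qed.

(** * The lower bound for the liminf by Fatou's lemma *)

Lemma limn_einf_ge (R : realType) (u : (\bar R)^nat) (b : \bar R) :
  (\forall n \near \oo, b <= u n)%E -> (b <= limn_einf u)%E.
Proof.
move=> [N _ bu]; rewrite limn_einf_lim; apply: lime_ge; first exact: is_cvg_einfs.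
exists N => // n /= Nn; apply: le_ereal_inf_tmp => _ [k /= nk <-].
by apply: bu => /=; exact: leq_trans nk.
Qed.

Lemma limn_einf_le (R : realType) (u : (\bar R)^nat) (b : \bar R) :
  (forall n, u n <= b)%E -> (limn_einf u <= b)%E.
Proof.
move=> ub; rewrite limn_einf_lim; apply: lime_le; first exact: is_cvg_einfs.
apply: nearW => n; apply: le_trans (ub n); apply: ereal_inf_lbound.
by exists n => /=.
Qed.

Lemma phi_nonneg (R : realType) (F : probability (measurableTypeR R) R) (g : R) :
  on_nonneg F -> phi F g = (\int[F]_(x in `[0%R, +oo[) (expR (g * x))%:E)%E.
Proof.
move=> F0; have mN : measurable [set x : R | x < 0].
  rewrite (_ : mkset _ = `]-oo, 0[%classic); first exact: measurable_itv.
  by apply/seteqP; split => z /=; rewrite in_itv.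
rewrite /phi (@ge0_negligible_integral _ _ _ F _ _ _ mN measurableT (measurable_expRZ R g) _ F0); last first.
  by move=> x _; rewrite lee_fin expR_ge0.
congr (integral _ _ _); apply/seteqP; split => x /=; rewrite in_itv/= andbT.
  by move=> [_ /negP]; rewrite -leNgt.
by move=> x0; split => //; apply/negP; rewrite -leNgt.
Qed.

(** Every real [g] up to [ghat] is covered, so that an infinite [ghat] can be treated by letting [g]
    grow. *)
Lemma phi_le_liminf (R : realType) (F : probability (measurableTypeR R) R) (g : R) :
  on_nonneg F -> unbounded_support F -> (g%:E <= ghat F)%E ->
  (forall y : R, 0 < y ->
     (exp_ghat F y <= limf_einf (fun x : R => (tail F (x - y) / tail F x)%:E) +oo%R)%E) ->
  (2%:E * phi F g <=
    limf_einf (fun x : R => (conv_tail F x / tail F x)%:E) +oo%R)%E.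
Proof.
move=> F0 supp gle hyp.
set L := limf_einf _ _.
have phi0 : (0 <= phi F g)%E by apply: integral_ge0 => x _; rewrite lee_fin expR_ge0.
have key (r : R) : (L < r%:E)%E -> (2%:E * phi F g <= r%:E)%E.
  move=> Lr.
  (* Since the liminf is below [r], points beyond any [n] have ratio below [r]; they form the
     sequence for Fatou's lemma. *)
  have /choice[x_ x_P] n : exists x : R, n%:R < x /\ conv_tail F x / tail F x < r.
    have : (ereal_inf ((fun x : R => (conv_tail F x / tail F x)%:E) @` `]n%:R, +oo[%classic)
        < r%:E)%E.
      apply: le_lt_trans Lr; rewrite /L limf_einfE; apply: ereal_sup_ubound.
      exists `]n%:R, +oo[%classic => //; exists n%:R; split; first exact: num_real.
      by move=> x /= nx; rewrite in_itv/= nx.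
    move=> /ereal_inf_lt[_ [x /= + <-]]; rewrite in_itv/= andbT lte_fin => nx xr.
    by exists x.
  pose f n (y : R) := (half_tail F (x_ n) y / tail F (x_ n))%:E.
  have mh n : measurable_fun setT (half_tail F (x_ n)) by exact: measurable_half_tail.
  have mf n : measurable_fun setT (f n).
    by apply/measurable_EFinP; apply: measurable_funM.
  have f0 n y : (0 <= f n y)%E.
    by rewrite lee_fin divr_ge0// ?half_tail_ge0// tail_ge0.
  have intf n : (\int[F]_(y in `[0%R, +oo[) f n y <= (r / 2)%:E)%E.
    apply: (@le_trans _ _ (\int[F]_y f n y)%E).
      by apply: ge0_subset_integral => //; exact: mf.
    have [_ xr] := x_P n; have tx := supp (x_ n).
    rewrite /f; under eq_integral do rewrite mulrC EFinM.
    rewrite ge0_integralZl//; [|by apply/measurable_EFinP; exact: mh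
      |by move=> y _; rewrite lee_fin half_tail_ge0|by rewrite lee_fin invr_ge0 ltW].
    rewrite -(@lee_pmul2l _ 2%:E)// -EFinM mulrCA divff// mulr1.
    rewrite muleCA -(@lee_pmul2l _ (tail F (x_ n))%:E) ?lte_fin// !muleA -!EFinM.
    rewrite divff ?gt_eqF// mul1r (le_trans (conv_tail_ge _ _ _))//.
    by rewrite lee_fin mulrC -ler_pdivrMr// ltW.
  suff phile : (phi F g <= (r / 2)%:E)%E.
    by rewrite (_ : r%:E = 2%:E * (r / 2)%:E)%E ?lee_pmul2l// -EFinM mulrCA divff// mulr1.
  have mD : measurable (`[0%R, +oo[%classic : set R) by [].
  have mfD n : measurable_fun (`[0%R, +oo[%classic : set R) (f n).
    by apply: measurable_funTS; exact: mf.
  have fat := fatou F mD mfD (fun n y _ => f0 n y).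
  rewrite phi_nonneg//; apply: (le_trans _ (le_trans fat (limn_einf_le _ _ _ intf))).
  have mexp : measurable_fun (`[0%R, +oo[%classic : set R) (fun y : R => (expR (g * y))%:E).
    by apply: measurable_funTS; exact: measurable_expRZ.
  have mlim : measurable_fun (`[0%R, +oo[%classic : set R) (fun y => limn_einf (f ^~ y)).
    rewrite /limn_einf; apply: measurableT_comp => //.
    by apply: measurable_fun_limn_esup => n; apply: measurableT_comp => //; exact: mfD.
  have e0 (y : R) : `[0%R, +oo[%classic y -> (0 <= (expR (g * y))%:E)%E.
    by rewrite lee_fin expR_ge0.
  apply: (ge0_le_integral F mD e0 mexp mlim).
  (* The hypothesis speaks of positive [y] only; at 0 the integrand [f n] and the exponential are
     both 1. *)
  move=> y; rewrite /= in_itv/= andbT le_eqVlt => /orP[/eqP <-|y0].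
    rewrite mulr0 expR0; apply: limn_einf_ge; apply: nearW => n.
    have [nx _] := x_P n; rewrite /f /half_tail subr0 indicE mem_set ?mul1r ?divff ?gt_eqF//=.
    by rewrite divr_ge0// (le_trans _ (ltW nx)).
  apply: (@le_trans _ _ (exp_ghat F y)).
    move: gle; rewrite /exp_ghat; case: (ghat F) => [h| |]; rewrite ?leey ?leeNy_eq// !lee_fin.
    by move=> gh; rewrite ler_expR ler_wpM2r// ltW.
  apply: (le_trans (hyp _ y0)); rewrite limf_einfE.
  apply: ge_ereal_sup => _ [V [M [_ MV]] <-].
  (* Once [n] exceeds [2 * y] and [M], the indicator in [half_tail] is 1 and [x_ n] lies in [V]. *)
  apply: limn_einf_ge; near=> n.
  have [nx _] := x_P n.
  rewrite /f /half_tail indicE mem_set ?mul1r/=; last first.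
    rewrite ler_pdivlMr// mulrC (le_trans _ (ltW nx))//.
    near: n; exact: nbhs_infty_ger.
  apply: ereal_inf_lbound; exists (x_ n) => //; apply: MV => /=.
  rewrite (le_lt_trans _ nx)//; near: n; exact: nbhs_infty_ger.
(* The value [-oo] is excluded: [key] at -1 would put a nonnegative quantity below -1. *)
move: (L) key => [l| |] key; last 2 first.
- by rewrite leey.
- have := key (-1) (ltNyr _); rewrite leNgt => /negP[].
  by rewrite (@lt_le_trans _ _ 0%E) ?lte_fin ?ltrN10// mule_ge0.
by apply/lee_addgt0Pr => e e0; apply: key; rewrite lte_fin ltrDl.
Unshelve. all: by end_near. Qed.

(** * Monotonicity and limits of [phi] *)

Lemma phi_nondecreasing (R : realType) (F : probability (measurableTypeR R) R) :
  on_nonneg F -> {homo phi F : x y / (x <= y)%R >-> (x <= y)%E}.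
Proof.
move=> F0 g h gh; rewrite !phi_nonneg//.
have mexp (c : R) : measurable_fun (`[0%R, +oo[%classic : set R) (fun y : R => (expR (c * y))%:E).
  by apply: measurable_funTS; exact: measurable_expRZ.
have mD : measurable (`[0%R, +oo[%classic : set R) by [].
apply: (ge0_le_integral F mD _ (mexp g) (mexp h)).
  by move=> y _; rewrite lee_fin expR_ge0.
move=> y; rewrite /= in_itv/= andbT => y0.
by rewrite lee_fin ler_expR ler_wpM2r.
Qed.

(** By monotonicity the left limit is a supremum at most [phi F r]; Fatou's lemma along
    [r - n.+1%:R^-1] gives the converse, also when [phi F r] is infinite. *)
Lemma lim_phi_at_left (R : realType) (F : probability (measurableTypeR R) R) (r : R) :
  on_nonneg F -> lim (phi F @ r^'-) = phi F r.
Proof.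
(* Reflection turns the left limit at [r] into the right limit at [- r] of a nonincreasing
   function. *)
move=> F0; pose phiN (x : R) := phi F (- x).
have ni : {in `]- r, +oo[ &, nonincreasing_fun phiN}.
  by move=> x y _ _ xy; apply: phi_nondecreasing => //; rewrite lerN2.
have := @nonincreasing_at_right_cvge R phiN (- r) +oo%O isT ni.
move=> /(@cvg_at_leftNP _ R (phi F) r) /cvg_lim ->//.
apply/eqP; rewrite eq_le; apply/andP; split.
  apply: ge_ereal_sup => _ [x /= + <-]; rewrite in_itv/= andbT => rx.
  by apply: phi_nondecreasing => //; rewrite lerNl ltW.
pose g n := r - n.+1%:R^-1.
have gr : g n @[n --> \oo] --> r.
  by rewrite -[X in _ --> X]subr0; apply: cvgB; [exact: cvg_cst|exact: cvg_harmonic].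
have mf n : measurable_fun setT (fun x : R => (expR (g n * x))%:E) by exact: measurable_expRZ.
have f0 n x : setT x -> (0 <= (expR (g n * x))%:E)%E by rewrite lee_fin expR_ge0.
have := fatou F measurableT mf f0.
under eq_integral => x _.
  rewrite (cvg_limn_einf_sup (_ : _ --> (expR (r * x))%:E)).1; last first.
    apply: cvg_EFin; first exact: nearW.
    apply: (@continuous_cvg _ _ _ _ _ _ expR); first exact: continuous_expR.
    by apply: cvgMl.
  over.
move=> /le_trans; apply; apply: limn_einf_le => n; apply: ereal_sup_ubound.
exists (- g n) => /=; last by rewrite /phiN opprK.
by rewrite in_itv/= andbT ltrN2 gtrBl invr_gt0.
Qed.

(** The mass beyond 1 is positive and contributes at least [expR g * tail F 1] when [g >= 0]. *)
Lemma lim_phi_pinfty (R : realType) (F : probability (measurableTypeR R) R) :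
  unbounded_support F -> phi F g @[g --> +oo%R] --> +oo%E.
Proof.
move=> supp; have t1 := supp 1.
apply/cvgeyPge => A; near=> g.
have g0 : 0 <= g by near: g; apply: nbhs_pinfty_ge; exact: num_real.
have Ag : A / tail F 1 <= g by near: g; apply: nbhs_pinfty_ge; exact: num_real.
apply: (@le_trans _ _ (\int[F]_(x in `]1%R, +oo[) (cst (expR g)%:E x))%E).
  rewrite integral_cst//= tailE -EFinM lee_fin -ler_pdivrMr// (le_trans Ag)//.
  by rewrite (le_trans _ (expR_ge1Dx _))// lerDr.
apply: (@le_trans _ _ (\int[F]_(x in `]1%R, +oo[) (expR (g * x))%:E)%E).
  have mD : measurable (`]1%R, +oo[%classic : set R) by [].
  have mexp : measurable_fun (`]1%R, +oo[%classic : set R) (fun x : R => (expR (g * x))%:E).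
    by apply: measurable_funTS; exact: measurable_expRZ.
  apply: (ge0_le_integral F mD _ _ mexp) => [x _||]; [by rewrite lee_fin expR_ge0|by []|].
  move=> x; rewrite /= in_itv/= andbT => /ltW x1.
  by rewrite lee_fin ler_expR ler_peMr.
by apply: ge0_subset_integral => //; exact: measurable_expRZ.
Unshelve. all: by end_near. Qed.

(** * The upper bound and the conclusion *)

(** A liminf above [2 * c] would give an excess [e] valid for all large arguments, which
    [no_uniform_excess] forbids; [phi] is infinite beyond [r] because [r] is the supremum [ghat]. *)
Lemma liminf_le_phi (R : realType) (F : probability (measurableTypeR R) R) (r : R) :
  unbounded_support F -> ghat F = r%:E -> 0 < r ->
  (limf_einf (fun x : R => (conv_tail F x / tail F x)%:E) +oo%R <= 2%:E * phi F r)%E.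
Proof.
move=> supp gr r0.
have phi0 : (0 <= phi F r)%E by apply: integral_ge0 => x _; rewrite lee_fin expR_ge0.
have [->|phioo] := eqVneq (phi F r) +oo%E; first by rewrite gt0_muley ?leey.
have phi_fin : phi F r \is a fin_num by rewrite ge0_fin_numE// ltey.
rewrite -(fineK phi_fin); set c := fine _; rewrite -EFinM leNgt; apply/negP.
rewrite limf_einfE => /ereal_sup_gt[_ [V [M [_ MV]] <-] cV].
(* The infimum over [V] may be [+oo]; any positive excess then works, and 1 is taken. *)
have [e e0 eV] : exists2 e : R, 0 < e & ((2 * c + e)%:E <=
    ereal_inf ((fun x : R => (conv_tail F x / tail F x)%:E) @` V))%E.
  move: cV; case: ereal_inf => [l| |]//; last by exists 1 => //; rewrite leey.
  by rewrite lte_fin => cl; exists (l - 2 * c); rewrite ?subr_gt0// lee_fin; lra.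
(* Positive, and beyond [M] strictly, so that every [a >= x0] lies in [V]. *)
pose x0 := Num.max M 0 + 1.
have x00 : 0 < x0 by rewrite ltr_wpDl// le_max lexx orbT.
apply: (no_uniform_excess R F r c e x0) => //.
- exact: ltW.
- by rewrite fineK.
- move=> d d0; apply/eqP; rewrite -leye_eq leNgt; apply/negP => fin.
  have : ((r + d)%:E <= ghat F)%E by apply: ereal_sup_ubound; exists (r + d).
  by rewrite gr lee_fin leNgt ltrDl d0.
- move=> a x0a; rewrite tailE conv_tailE -EFinM lee_fin -ler_pdivlMr//.
  rewrite -lee_fin (le_trans eV)//; apply: ereal_inf_lbound; exists a => //.
  by apply: MV; rewrite (lt_le_trans _ x0a)// ltr_pwDr// le_max lexx.
Qed.

Theorem theorem2 (R : realType) (F : probability (measurableTypeR R) R) :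
  on_nonneg F -> unbounded_support F -> (0 < ghat F)%E ->
  (forall y : R, 0 < y ->
     (exp_ghat F y <= limf_einf (fun x : R => (tail F (x - y) / tail F x)%:E) +oo%R)%E) ->
  limf_einf (fun x : R => (conv_tail F x / tail F x)%:E) +oo%R = (2 * phi_ghat F)%E.
Proof.
move=> F0 supp g0 hyp.
have lower g := phi_le_liminf R F g F0 supp ^~ hyp.
rewrite /phi_ghat; case gE : (ghat F) g0 => [r| |]// g0.
  rewrite lim_phi_at_left//; apply/eqP; rewrite eq_le; apply/andP; split.
    exact: liminf_le_phi.
  by apply: lower; rewrite gE.
(* For infinite [ghat] the right side is [+oo], and the liminf dominates [phi F g] for every real
   [g], hence every positive [A]. *)
have phiy := lim_phi_pinfty R F supp.
rewrite (cvg_lim _ phiy)// gt0_muley ?lte_fin//; apply/eqyP => A A0.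
near (+oo%R : set_system R) => g.
apply: (@le_trans _ _ (phi F g)).
  by near: g; move/cvgeyPge : phiy; exact.
apply: le_trans (lower g _); last by rewrite gE leey.
rewrite -[leLHS]mul1e lee_wpmul2r ?lee_fin//.
  by apply: integral_ge0 => x _; rewrite lee_fin expR_ge0.
by rewrite ler1n.
Unshelve. all: by end_near. Qed.
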